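(* If $k\ge 3$ and $n\ge 3$ is odd then there exists a maximal $\mathcal{NAS}_k(n)$.
   Context: For a sequence $S=(s_i)_{i\ge0}$ with entries in $\mathbb{Z}_k$ write $\mathbf{s}_n(i)=(s_i,\dots,s_{i+n-1})$; an $n$-tuple occurs in $S$ if it equals $\mathbf{s}_n(i)$ for some $i$. A $k$-ary $n$-window sequence is a periodic sequence over $\mathbb{Z}_k$, of period $m$ say, such that $\mathbf{s}_n(i)=\mathbf{s}_n(j)$ implies $i\equiv j\pmod m$. For $k\ge3$, $n\ge2$, an $\mathcal{NAS}_k(n)$ ($k$-ary Negative Avoiding Sequence of span $n$) is a $k$-ary $n$-window sequence $S$ such that whenever an $n$-tuple $\mathbf{a}=(a_0,\dots,a_{n-1})$ occurs in $S$, its negative $-\mathbf{a}=(-a_0,\dots,-a_{n-1})$ does not occur in $S$. An $\mathcal{NAS}_k(n)$ is maximal if its period equals $\frac{k^n-1}{2}$ when $k$ is odd, or $\frac{k^n-2^n}{2}$ when $k$ is even. *)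

(* Defs.v *)
From mathcomp Require Import all_boot all_order all_algebra.

Set Implicit Arguments.
Unset Strict Implicit.
Unset Printing Implicit Defensive.

Import GRing.Theory.
Local Open Scope ring_scope.

(* MathComp's 'Z_k is the ring of integers mod k only when 1 < k. *)

Definition window (k n : nat) (s : nat -> 'Z_k) (i : nat) : 'rV['Z_k]_n :=
  \row_(j < n) s (i + j)%N.

Definition occurs (k n : nat) (s : nat -> 'Z_k) (a : 'rV['Z_k]_n) : Prop :=
  exists i : nat, window n s i = a.

Definition has_period (k m : nat) (s : nat -> 'Z_k) : Prop :=
  (0 < m)%N /\ forall i : nat, s (i + m)%N = s i.

(* The window condition forces m to be the least period of s: if p is any
   period then window n s p = window n s 0, so m divides p. *)
Definition window_sequence (k n m : nat) (s : nat -> 'Z_k) : Prop :=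
  has_period m s /\
  forall i j : nat, window n s i = window n s j -> i = j %[mod m].

Definition NAS (k n m : nat) (s : nat -> 'Z_k) : Prop :=
  window_sequence n m s /\
  forall a : 'rV['Z_k]_n, occurs s a -> ~ occurs s (- a).

(* Both divisions are exact. *)
Definition NAS_max_period (k n : nat) : nat :=
  if odd k then ((k ^ n - 1) %/ 2)%N else ((k ^ n - 2 ^ n) %/ 2)%N.

Definition maximal_NAS (k n : nat) (s : nat -> 'Z_k) : Prop :=
  NAS n (NAS_max_period k n) s.

(* Main.v *)
(** Let the edges of a subgraph of the de Bruijn graph be the n-tuples of a set
    [T] closed under cyclic rotation.  Rotation splits [T] into cycles, and two
    cycles through a common vertex can be joined by a transposition, so [T] is
    the set of windows of a single periodic sequence as soon as it is connected
    under rotations and changes of one entry.  For odd n a tuple that is a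
    rotation of its own negative equals its negative, hence from each pair
    {a, -a} with a <> -a one can choose one member consistently on rotation
    classes.  Choosing the member with more positive entries (ties being broken
    arbitrarily) makes [T] connected: every member can be changed entry by
    entry, within [T], into the all-one tuple. *)
Require Import Defs.
From mathcomp Require Import all_boot all_order all_algebra.
From mathcomp Require Import perm fingroup zify.

Set Implicit Arguments.
Unset Strict Implicit.
Unset Printing Implicit Defensive.

Import GroupScope GRing.Theory.

(** * Merging cycles of a permutation *)

(* Take a permutation [s * r] with the fewest cycles: [s] preserves [f] and [T],
   and so does [tperm x y * s] if [x], [y] in [T] have the same image by [f]. *)
Lemma join_cycles (V : finType) (W : eqType) (f : V -> W) (T : {set V})
    (r : {perm V}) :
  exists s : {perm V},
    [/\ forall x, f (s x) = f x, forall x, (s x \in T) = (x \in T)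
      & {in T &, forall x y, f x = f y -> x \in porbit (s * r) y}].
Proof.
pose P (s : {perm V}) :=
  [forall x, (f (s x) == f x) && ((s x \in T) == (x \in T))].
have P1 : P 1 by apply/forallP=> x; rewrite perm1 !eqxx.
case: (arg_minnP (fun s => #|porbits (s * r)|) P1) => s /forallP Ps smin.
have fs x : f (s x) = f x by case/andP: (Ps x) => /eqP.
have Ts x : (s x \in T) = (x \in T) by case/andP: (Ps x) => _ /eqP.
exists s; split=> // x y Tx Ty fxy.
have /smin le_s : P (tperm x y * s).
  apply/forallP=> z; rewrite permM fs Ts.
  by case: tpermP => [->|->|]; rewrite ?fxy ?Tx ?Ty !eqxx.
apply: contraT => xNy.
have := porbits_mul_tperm (s * r) x y.
rewrite /= mulgA xNy => eq_s; move: le_s.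
by rewrite -(leq_add2r 2) eq_s leq_add2l; case: (x != y).
Qed.

(** * Cyclic rotation of tuples *)

Section Rotation.
Variables (A : finType) (n : nat).

Definition rotv (a : 'rV[A]_n) : 'rV[A]_n := \row_j a ord0 (ordS j).

Lemma rotv_inj : injective rotv.
Proof.
move=> a b /rowP eq_ab; apply/rowP=> j.
by have := eq_ab (ord_pred j); rewrite !mxE ord_predK.
Qed.

Definition rot_perm : {perm 'rV[A]_n} := perm rotv_inj.

Lemma rot_permX m (a : 'rV[A]_n) j :
  (rot_perm ^+ m) a ord0 j = a ord0 (iter m (@ordS n) j).
Proof.
elim: m j => [|m IHm] j; first by rewrite perm1.
by rewrite expgSr permM permE mxE IHm iterSr.
Qed.

Lemma val_iter_ordS m (j : 'I_n) : iter m (@ordS n) j = ((j + m) %% n)%N :> nat.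
Proof.
elim: m => [|m IHm]; first by rewrite addn0 modn_small.
by rewrite iterS /= IHm -addn1 modnDml addn1 addnS.
Qed.

Lemma rot_permXn : rot_perm ^+ n = 1.
Proof.
apply/permP=> a; apply/rowP=> j; rewrite rot_permX perm1; congr (a _ _).
by apply: val_inj; rewrite [LHS]val_iter_ordS modnDr modn_small.
Qed.

End Rotation.

(** * De Bruijn cycles joined from rotation classes *)

Section Joining.
Variables (A : finType) (n : nat) (T : {set 'rV[A]_n.+1}).
Hypothesis rotT : forall a, (rotv a \in T) = (a \in T).
Notation r := (@rot_perm A n.+1).

Lemma rot_permX_mem m a : ((r ^+ m) a \in T) = (a \in T).
Proof.
elim: m => [|m IHm]; first by rewrite perm1.
by rewrite expgSr permM permE rotT.
Qed.

(** The [s] of [join_cycles] alters only entry 0, which [r] then moves to the end, so [s * r] maps a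
    tuple to a successor in the de Bruijn graph. A difference at entry [j] is brought to entry 0 by
    [j] rotations. *)
Lemma join_rotations :
  exists p : {perm 'rV[A]_n.+1},
    [/\ forall a, col' ord_max (p a) = col' ord0 a,
        forall a, (p a \in T) = (a \in T)
      & {in T &, forall a b j, col' j a = col' j b -> a \in porbit p b}].
Proof.
have [s [fs Ts conn]] := join_cycles (@col' A 1 n.+1 ord0) T r.
exists (s * r); split.
- move=> a; rewrite permM permE -fs; apply/rowP=> j; rewrite !mxE.
  congr (s a _ _); apply: val_inj => /=.
  by rewrite /bump leq0n leqNgt ltn_ord add0n modn_small ?ltnS.
- by move=> a; rewrite permM permE rotT.
(* Rotation stays on the cycle: [r a] is the image of [s^-1 a], which differs from [a] at most in
   entry 0. *)
have rot_conn a : a \in T -> porbit (s * r) (r a) = porbit (s * r) a.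
  move=> Ta; have Tsa : s^-1 a \in T by rewrite -Ts permKV.
  have -> : r a = (s * r) (s^-1 a) by rewrite permM permKV.
  transitivity (porbit (s * r) (s^-1 a)); first exact: (porbit_perm _ 1).
  by apply/eqP; rewrite eq_porbit_mem conn // -fs permKV.
have rotX_conn m a : a \in T -> porbit (s * r) ((r ^+ m) a) = porbit (s * r) a.
  move=> Ta; elim: m => [|m IHm]; first by rewrite perm1.
  by rewrite expgSr permM rot_conn ?rot_permX_mem.
move=> a b Ta Tb j eq_ab; rewrite -eq_porbit_mem.
rewrite -(rotX_conn j a) // -(rotX_conn j b) //.
rewrite eq_porbit_mem conn ?rot_permX_mem //.
apply/rowP=> i; rewrite !mxE !rot_permX.
(* [l] is [i.+1 + j] modulo [n.+1], and 0 < [i.+1] < [n.+1]. *)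
set l := iter _ _ _; have jl : j != l.
  apply/eqP=> /(congr1 val); rewrite [RHS]val_iter_ordS /= /bump leq0n add1n.
  have := ltn_ord i; have := ltn_ord j => lt_j lt_i.
  case: (ltnP (i.+1 + j) n.+1) => [lt|ge]; first by rewrite modn_small //; lia.
  rewrite -(subnK ge) modnDr modn_small; lia.
have [i' -> _] := unlift_some jl.
by move/rowP/(_ i'): eq_ab; rewrite !mxE.
Qed.

End Joining.

(** * The sequence read off a cycle *)

Section Sequence.
Variables (k n : nat) (T : {set 'rV['Z_k]_n.+1}) (a0 : 'rV['Z_k]_n.+1).
Variable p : {perm 'rV['Z_k]_n.+1}.
Hypothesis p_shift : forall a, col' ord_max (p a) = col' ord0 a.

Definition orbit_seq (i : nat) : 'Z_k := (p ^+ i) a0 ord0 ord0.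

(** Each application of [p] shifts by one place, so entry [j] of a point is the first entry of the
    point [j] steps later. *)
Lemma window_orbit_seq i : window n.+1 orbit_seq i = (p ^+ i) a0.
Proof.
apply/rowP=> -[j lt_j]; rewrite mxE /=.
elim: j i lt_j => [|j IHj] i lt_j.
  by rewrite addn0; congr (_ _ _); apply: val_inj.
rewrite addnS -addSn (IHj i.+1 (ltnW lt_j)) expgSr permM.
have lt_jn : (j < n)%N by [].
have /rowP/(_ (Ordinal lt_jn)) := p_shift ((p ^+ i) a0).
rewrite !mxE => eq_p.
transitivity (p ((p ^+ i) a0) ord0 (lift ord_max (Ordinal lt_jn))).
  by congr (p _ _ _); apply: val_inj; rewrite /= /bump leqNgt lt_jn.
by rewrite eq_p; congr ((p ^+ i) a0 _ _); apply: val_inj.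
Qed.

Lemma orbit_window_sequence :
  window_sequence n.+1 #|porbit p a0| orbit_seq.
Proof.
have per : (p ^+ #|porbit p a0|) a0 = a0 by rewrite permX iter_porbit.
have card_gt0 : (0 < #|porbit p a0|)%N.
  by apply/card_gt0P; exists a0; apply: porbit_id.
have modX i : (p ^+ i) a0 = (p ^+ (i %% #|porbit p a0|)) a0.
  rewrite {1}(divn_eq i #|porbit p a0|) expgD permM; congr (_ _).
  elim: (i %/ _)%N => [|q IHq]; first by rewrite perm1.
  by rewrite mulSn expgD permM per.
split; first split=> // i.
  by rewrite /orbit_seq addnC expgD permM per.
move=> i j; rewrite !window_orbit_seq (modX i) (modX j) !permX => eq_ij.
have := uniq_traject_porbit p a0.
move: (#|porbit p a0|) card_gt0 eq_ij => m m_gt0.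
rewrite -(nth_traject _ (ltn_pmod i m_gt0)) -(nth_traject _ (ltn_pmod j m_gt0)).
by move=> /eqP + uniq_m; rewrite nth_uniq ?size_traject ?ltn_mod // => /eqP.
Qed.

End Sequence.

(** * Signs of residues and self-negative tuples *)

Local Open Scope ring_scope.

(* The residues 1, ..., ceil(k/2) - 1. *)
Definition positive k (x : 'Z_k) : bool := (x < (- x : 'Z_k))%N.

Lemma positive1 k : (3 <= k)%N -> positive (1 : 'Z_k).
Proof. by case: k => [|[|[|k]]] // _; rewrite /positive /= !modn_small. Qed.

Lemma positiveN k (x : 'Z_k) : positive x -> ~~ positive (- x).
Proof. by rewrite /positive opprK -leqNgt => /ltnW. Qed.

Lemma not_positive k (x : 'Z_k) : x != - x -> ~~ positive x -> positive (- x).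
Proof. by rewrite /positive opprK -leqNgt ltn_neqAle eq_sym => -> ->. Qed.

(** The solutions of 2x = 0 are 0 and, for even [k], also k/2. *)
Lemma card_eqN_Zk k : (2 <= k)%N ->
  #|[set x : 'Z_k | x == - x]| = (if odd k then 1 else 2)%N.
Proof.
case: k => [|[|k]] // _.
have eqN (x : 'Z_k.+2) : (x == - x) = (x == 0%N :> nat) || (x.*2 == k.+2).
  rewrite -val_eqE /= /Zp_opp /=; have := ltn_ord x.
  move: (nat_of_ord x) => m lt_m.
  have [->|m_gt0] := posnP m; first by rewrite subn0 modnn.
  rewrite modn_small; last by lia.
  by rewrite /Zp_trunc /= in lt_m *; apply/eqP/eqP; lia.
case: ifPn => [odd_k|even_k].
  rewrite -(cards1 (0 : 'Z_k.+2)); apply: eq_card => x; rewrite !inE eqN.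
  rewrite -val_eqE /=; apply/orP/eqP => [[/eqP //|/eqP eq_k]|->]; last by left.
  by have := odd_double x; rewrite eq_k odd_k.
have lt_h : (k.+2./2 < k.+2)%N by lia.
have h_ne0 : 0 != Ordinal lt_h :> 'Z_k.+2 by rewrite -val_eqE.
transitivity #|[set (0 : 'Z_k.+2); Ordinal lt_h]|; last by rewrite cards2 h_ne0.
apply: eq_card => x; rewrite !inE eqN -!val_eqE /=; congr (_ || _).
by apply/eqP/eqP; lia.
Qed.

Lemma card_eqN_row k n : (2 <= k)%N ->
  #|[set a : 'rV['Z_k]_n | a == - a]| = ((if odd k then 1 else 2) ^ n)%N.
Proof.
move=> hk; rewrite -(card_eqN_Zk hk).
rewrite -[in RHS](card_ord n) -card_ffun_on.
pose toffun (a : 'rV['Z_k]_n) := [ffun j => a ord0 j].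
have toffun_inj : injective toffun.
  by move=> a b /ffunP eq_ab; apply/rowP=> j; have := eq_ab j; rewrite !ffunE.
rewrite -(card_imset _ toffun_inj); apply: eq_card => f.
apply/imsetP/ffun_onP => [[a]|fN].
  by rewrite inE => /eqP/rowP eqN -> j; rewrite inE ffunE {1}eqN mxE.
exists (\row_j f j); last by apply/ffunP=> j; rewrite ffunE mxE.
rewrite inE; apply/eqP/rowP=> j; rewrite !mxE; apply/eqP.
by have := fN j; rewrite inE.
Qed.

(** * Choosing one member of each pair of negatives *)

Section Choice.
Variables (k n : nat).
Hypotheses (hk : (3 <= k)%N) (hodd : odd n).
Implicit Types a b : 'rV['Z_k]_n.

Definition num_positive a : nat := #|[set j | positive (a ord0 j)]|.

(** An arbitrary numbering of the rotation classes, which breaks ties in the same way along a whole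
    class. *)
Definition class_rank a : nat := enum_rank (porbit (@rot_perm 'Z_k n) a).

Definition chosen : {set 'rV['Z_k]_n} :=
  [set a | (num_positive (- a) < num_positive a)%N
    || (num_positive (- a) == num_positive a)
       && (class_rank (- a) < class_rank a)%N].

Lemma rotvN a : rotv (- a) = - rotv a.
Proof. by apply/rowP=> j; rewrite !mxE. Qed.

Lemma rot_permXN m a :
  (rot_perm 'Z_k n ^+ m)%g (- a) = - (rot_perm 'Z_k n ^+ m)%g a.
Proof. by apply/rowP=> j; rewrite mxE !rot_permX mxE. Qed.

(** If rotation by [m] places negates [a], then repeating it [n] times gives [- a], as [n] is odd,
    but also [a], as [n] single rotations make a full turn. *)
Lemma class_rank_opp a : (class_rank (- a) == class_rank a) = (a == - a).
Proof.
apply/eqP/eqP => [|<- //] /val_inj /enum_rank_inj /eqP.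
rewrite eq_porbit_mem => /porbitP[m eq_m].
have iterN q : (rot_perm 'Z_k n ^+ (m * q))%g a = if odd q then - a else a.
  elim: q => [|q IHq]; first by rewrite muln0 perm1.
  rewrite mulnS expgD permM -eq_m rot_permXN IHq /=.
  by case: odd; rewrite ?opprK.
by have := iterN n; rewrite hodd mulnC expgM rot_permXn expg1n perm1.
Qed.

Lemma num_positive_rot a : num_positive (rotv a) = num_positive a.
Proof.
rewrite /num_positive -(card_imset _ (@ordS_inj n)); congr #|pred_of_set _|.
apply/setP=> j; rewrite inE; apply/imsetP/idP=> [[i + ->]|pos_j].
  by rewrite inE mxE.
by exists (ord_pred j); rewrite ?inE ?mxE ord_predK.
Qed.

Lemma class_rank_rot a : class_rank (rotv a) = class_rank a.
Proof.
rewrite /class_rank -(permE (@rotv_inj 'Z_k n)).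
by rewrite (porbit_perm (rot_perm 'Z_k n) 1).
Qed.

Lemma chosen_rot a : (rotv a \in chosen) = (a \in chosen).
Proof. by rewrite !inE -rotvN !num_positive_rot !class_rank_rot. Qed.

(** If [a] is not self-negative, [class_rank_opp] makes the lexicographic comparison of [a] with
    [- a] strict. *)
Lemma chosen_opp a : (- a \in chosen) = (a != - a) && (a \notin chosen).
Proof.
have [eqN|neN] := eqVneq a (- a); first by rewrite !inE -!eqN !ltnn andbF.
have := class_rank_opp a; rewrite (negPf neN) !inE opprK.
by case: (ltngtP (num_positive a)); case: (ltngtP (class_rank a)).
Qed.

(* Setting entries to 1 never decreases the number of positive entries nor
   increases the number of negative ones; from a tie one first raises a
   negative entry. *)
Definition set_one a (j : 'I_n) : 'rV['Z_k]_n :=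
  \row_i (if i == j then 1 else a ord0 i).

Lemma col'_set_one a j : col' j (set_one a j) = col' j a.
Proof. by apply/rowP=> i; rewrite !mxE eq_sym (negPf (neq_lift _ _)). Qed.

Lemma num_positive_set_one a j :
  num_positive (set_one a j) = (num_positive a + ~~ positive (a ord0 j))%N.
Proof.
rewrite /num_positive (cardsD1 j [set i | positive (a ord0 i)]).
rewrite (cardsD1 j [set i | positive (set_one a j ord0 i)]).
rewrite !inE mxE eqxx positive1 //.
rewrite addnC [in RHS]addnAC addnC; congr (_ + _)%N; first by case: positive.
by apply: eq_card => i; rewrite !inE mxE; case: eqP.
Qed.

Lemma num_negative_set_one a j :
  num_positive (- a) =
  (num_positive (- set_one a j) + positive (- a ord0 j))%N.
Proof.
rewrite /num_positive (cardsD1 j [set i | positive ((- a) ord0 i)]).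
rewrite (cardsD1 j [set i | positive ((- set_one a j) ord0 i)]) !inE !mxE eqxx.
rewrite (negPf (positiveN (positive1 hk))) add0n addnC; congr (_ + _)%N.
by apply: eq_card => i; rewrite !inE !mxE; case: eqP.
Qed.

Definition more_positive a := (num_positive (- a) < num_positive a)%N.

Lemma more_positive_chosen a : more_positive a -> a \in chosen.
Proof. by rewrite /more_positive inE => ->. Qed.

Lemma more_positive_set_one a j :
  more_positive a -> more_positive (set_one a j).
Proof.
rewrite /more_positive num_positive_set_one (num_negative_set_one a j) => lt_a.
exact: leq_trans (leq_ltn_trans (leq_addr _ _) lt_a) (leq_addr _ _).
Qed.

(** The first move already yields a strict majority of positive entries, which later moves
    preserve. *)
Lemma chosen_set_one a :
  a \in chosen -> exists j, more_positive (set_one a j).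
Proof.
move=> a_chosen; have neN : a != - a.
  by apply: contraL a_chosen => /eqP eqN; rewrite inE -eqN !ltnn andbF.
have [j neNj] : exists j, a ord0 j != - a ord0 j.
  apply/existsP; apply: contraR neN; rewrite negb_exists => /forallP eqN.
  by apply/eqP/rowP=> j; rewrite mxE; apply/eqP; rewrite -[_ == _]negbK.
have [lt_a|ge_a] := boolP (more_positive a).
  by exists j; apply: more_positive_set_one.
have /eqP eq_a : num_positive (- a) == num_positive a.
  by move: a_chosen; rewrite inE -/(more_positive a) (negPf ge_a) => /andP[].
(* If entry [j] is not itself negative it is positive, and the tie then forces a negative entry
   elsewhere. *)
have [i neg_i] : exists i, positive (- a ord0 i).
  have [|pos_j] := boolP (positive (- a ord0 j)); first by exists j.
  have : (0 < num_positive (- a))%N.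
    rewrite eq_a; apply/card_gt0P; exists j; rewrite inE.
    by apply: contraR pos_j => /(not_positive neNj).
  by case/card_gt0P=> i; rewrite inE mxE; exists i.
exists i; rewrite /more_positive num_positive_set_one -eq_a.
rewrite (num_negative_set_one a i) neg_i -addnA -[ltnLHS]addn0 ltn_add2l.
by rewrite addn_gt0.
Qed.

(** [R] stands for lying on a common cycle. After the first move the entries other than 1 are set to
    1 one at a time, by induction on their number. *)
Lemma chosen_connected (R : rel 'rV['Z_k]_n) :
    equivalence_rel R ->
    {in chosen &, forall a b j, col' j a = col' j b -> R a b} ->
  {in chosen, forall a, R a (const_mx 1)}.
Proof.
move=> /equivalence_relP[Rxx Rtrans] R1 a a_chosen.
have step b j : b \in chosen -> more_positive (set_one b j) ->
    R b (const_mx 1) = R (set_one b j) (const_mx 1).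
  move=> b_chosen more_b; apply: Rtrans; apply: (R1 _ _ b_chosen _ j).
    exact: more_positive_chosen.
  by rewrite col'_set_one.
have [j more_a] := chosen_set_one a_chosen.
rewrite (step _ j) //; move: (set_one a j) more_a => {a a_chosen j} a.
have [m] := ubnP #|[set j | a ord0 j != 1]|.
elim: m a => // m IHm a; rewrite ltnS => le_m more_a.
have [all1|[j]] := set_0Vmem [set j | a ord0 j != 1].
  suff -> : a = const_mx 1 by [].
  apply/rowP=> j; rewrite mxE; apply/eqP.
  by have := in_set0 j; rewrite -all1 inE => /negbFE.
rewrite inE => ne1; rewrite (step _ j) ?more_positive_chosen //; last first.
  exact: more_positive_set_one.
apply: IHm; last exact: more_positive_set_one.
apply: leq_trans le_m; apply: proper_card; apply/properP; split.
  by apply/subsetP=> i; rewrite !inE mxE; case: (i == j); rewrite ?eqxx.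
by exists j; rewrite !inE ?mxE ?eqxx.
Qed.

Lemma const1_chosen : (0 < n)%N -> const_mx 1 \in chosen.
Proof.
move=> n_gt0; apply: more_positive_chosen; rewrite /more_positive.
have -> : num_positive (- const_mx 1) = 0%N.
  by apply: eq_card0 => j; rewrite inE !mxE (negPf (positiveN (positive1 hk))).
by apply/card_gt0P; exists (Ordinal n_gt0); rewrite inE mxE positive1.
Qed.

(** The k^n tuples split into [chosen], its image under negation and the self-negative tuples. *)
Lemma card_chosen : #|chosen| = NAS_max_period k n.
Proof.
have cardN : #|-%R @: chosen| = #|chosen|.
  by rewrite card_imset //; apply: oppr_inj.
have mem_N a : (a \in -%R @: chosen) = (- a \in chosen).
  by rewrite -[in LHS](opprK a) mem_imset //; apply: oppr_inj.
have total : (k ^ n = 2 * #|chosen| + (if odd k then 1 else 2) ^ n)%N.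
  rewrite -(card_eqN_row n (ltnW hk)).
  transitivity #|'rV['Z_k]_n|.
    by rewrite card_mx card_ord mul1n Zp_cast // ltnW.
  rewrite -(cardsC chosen) -(cardsID [set a | a == - a] (~: chosen)).
  rewrite mul2n -addnn -addnA; congr (_ + _)%N; rewrite addnC -{1}cardN.
  congr (_ + _)%N; apply: eq_card => a; first by rewrite mem_N chosen_opp !inE.
  rewrite in_setI in_setC andb_idl // inE => /eqP eqN.
  by rewrite {1}eqN chosen_opp -eqN eqxx.
by rewrite /NAS_max_period total; case: (odd k); rewrite ?exp1n addnK mulKn.
Qed.

End Choice.

Local Close Scope ring_scope.

(** * The cycle through the all-one tuple *)

Theorem theorem5p7 (k n : nat) (hk : 3 <= k) (hn : 3 <= n) (hodd : odd n) :
  exists s : nat -> 'Z_k, @maximal_NAS k n s.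
Proof.
case: n hn hodd => // n _ hodd.
have rotT := @chosen_rot k n.+1.
have [p [p_shift pT p_conn]] := join_rotations rotT.
pose one : 'rV['Z_k]_n.+1 := const_mx 1%R.
have one_chosen : one \in chosen k n.+1 by apply: const1_chosen.
(* [p] preserves [chosen], so this cycle stays inside it; connectedness puts every chosen tuple on
   it. *)
have orbT : porbit p one = chosen k n.+1.
  apply/setP=> a; apply/idP/idP => [/porbitP[i ->]|a_chosen].
    by elim: i => [|i IHi]; rewrite ?perm1 // expgSr permM pT.
  have eqR : equivalence_rel (fun a b => a \in porbit p b).
    by apply/equivalence_relP; split=> [b|b c]; rewrite ?porbit_id // => + d;
      rewrite -eq_porbit_mem => /eqP eq_bc; rewrite -!eq_porbit_mem eq_bc.
  exact: (chosen_connected hk eqR p_conn).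
exists (orbit_seq one p); split.
  by rewrite -card_chosen // -orbT; apply: orbit_window_sequence.
have occ_chosen a : occurs (orbit_seq one p) a -> a \in chosen k n.+1.
  by case=> i; rewrite window_orbit_seq // -orbT => <-; apply: mem_porbit.
move=> a /occ_chosen a_chosen /occ_chosen.
by rewrite chosen_opp // a_chosen andbF.
Qed.
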